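(* Let $\gamma\in[0,\pi/2)$ and let $A,B\in\Pi_\gamma$ be $n\times n$ complex matrices such that $AB=BA$ and $AB^*=B^*A$. Then $$w(AB)\leq(1+\sin^2\gamma)\,w(A)\,w(B).$$
   Context: For $A\in\mathcal{M}_n$ (the $n\times n$ complex matrices), the numerical range is $W(A)=\{\langle Ax,x\rangle : x\in\mathbb{C}^n,\ \|x\|=1\}$ and the numerical radius is $w(A)=\sup\{|\langle Ax,x\rangle| : x\in\mathbb{C}^n,\ \|x\|=1\}$. For $\gamma\in[0,\pi/2)$ let $S_\gamma=\{z\in\mathbb{C} : \Re z>0,\ |\Im z|\leq(\tan\gamma)\Re z\}$. One writes $A\in\Pi_\gamma$ ($A$ is sectorial with sectorial index $\gamma$) when $W(A)\subseteq S_\gamma$. *)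

(* Defs.v *)
From mathcomp Require Import all_boot all_order all_algebra.
From mathcomp Require Import complex.
From mathcomp Require Import all_classical all_reals all_analysis.

Set Implicit Arguments.
Unset Strict Implicit.
Unset Printing Implicit Defensive.

Import Order.TTheory GRing.Theory Num.Theory.

Local Open Scope classical_set_scope.
Local Open Scope ring_scope.
Local Open Scope complex_scope.

(* <x, y> = \sum_i x_i * conj y_i; the transposes are there because [dotmx] is
   the standard Hermitian product on row vectors. *)
Definition inner (R : realType) (n : nat) (x y : 'cV[R[i]]_n) : R[i] :=
  dotmx x^T y^T.

(* The Euclidean norm; `|x| on matrices is the sup norm. *)
Definition enorm (R : realType) (n : nat) (x : 'cV[R[i]]_n) : R[i] :=
  sqrtC (inner x x).

Definition numerical_range (R : realType) (n : nat) (A : 'M[R[i]]_n) :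
    set R[i] :=
  [set inner (A *m x) x | x in [set x : 'cV[R[i]]_n | enorm x = 1]].

(* [Normc.normc] is the R-valued modulus on R[i]. *)
Definition numerical_radius (R : realType) (n : nat) (A : 'M[R[i]]_n) : R :=
  sup [set Normc.normc z | z in numerical_range A].

Definition sector (R : realType) (gamma : R) : set R[i] :=
  [set z : R[i] | 0 < complex.Re z /\
                  `|complex.Im z| <= tan gamma * complex.Re z].

Definition sectorial (R : realType) (gamma : R) (n : nat) (A : 'M[R[i]]_n) :
    Prop :=
  numerical_range A `<=` sector gamma.

(* Main.v *)
Require Import Defs.
From mathcomp Require Import all_boot all_order all_algebra.
From mathcomp Require Import complex.
From mathcomp Require Import all_classical all_reals all_analysis.
From mathcomp Require Import ring lra.

(** Put [s = sin gamma] and [w = w(B)]. The sector condition gives [Re B >= 0],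
[|Re B| <= w] and [|Im B| <= s w]. Polarizing, with [u = x + y], [v = x - y],

  4 Re <Bx, y> <= w |u|^2 + w (s^2 |u|^2 + |v|^2) <= 2 (1 + s^2) w (|x|^2 + |y|^2),

so the operator norm of [B] is at most [b = (1 + s^2) w]. It then suffices that
[w(AB) <= |B| w(A)] when [A] commutes with [B] and [B^*]. Since [B] is invertible,
[B / b] is the average of two unitary matrices that are products of [B] with
functions of [B^* B], hence commute with [A]. Finally [w(AU) <= w(A)] for a
unitary [U] commuting with [A]: [A] preserves the orthogonal eigenspaces of [U],
on each of which [U] is a scalar of modulus one. *)

Set Implicit Arguments.
Unset Strict Implicit.
Unset Printing Implicit Defensive.

Import Order.TTheory GRing.Theory Num.Theory.
Local Open Scope ring_scope.
Local Open Scope complex_scope.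
Local Open Scope sesquilinear_scope.

(** * The Hermitian inner product and the squared norm *)

Lemma innerE (R : realType) (n : nat) (x y : 'cV[R[i]]_n) :
  inner x y = \sum_i x i 0 * (y i 0)^*%C.
Proof.
by rewrite /inner dotmxE mxE; apply: eq_bigr => i _; rewrite !mxE.
Qed.

Lemma innerDl (R : realType) (n : nat) (x y z : 'cV[R[i]]_n) :
  inner (x + y) z = inner x z + inner y z.
Proof. by rewrite /inner linearD linearDl. Qed.

Lemma innerDr (R : realType) (n : nat) (x y z : 'cV[R[i]]_n) :
  inner x (y + z) = inner x y + inner x z.
Proof. by rewrite /inner linearD linearDr. Qed.

Lemma innerZl (R : realType) (n : nat) (a : R[i]) (x y : 'cV[R[i]]_n) :
  inner (a *: x) y = a * inner x y.
Proof. by rewrite /inner linearZ /= linearZl_LR. Qed.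

Lemma innerZr (R : realType) (n : nat) (a : R[i]) (x y : 'cV[R[i]]_n) :
  inner x (a *: y) = a^*%C * inner x y.
Proof. by rewrite /inner linearZ /= linearZr_LR. Qed.

Lemma innerC (R : realType) (n : nat) (x y : 'cV[R[i]]_n) :
  inner x y = (inner y x)^*%C.
Proof. by rewrite /inner (hermC _ x^T) expr0 mul1r. Qed.

Lemma inner_gt0 (R : realType) (n : nat) (x : 'cV[R[i]]_n) :
  x != 0 -> 0 < inner x x.
Proof.
by rewrite -(inj_eq trmx_inj) trmx0 /inner dnorm_gt0.
Qed.

Lemma inner_ge0 (R : realType) (n : nat) (x : 'cV[R[i]]_n) :
  0 <= inner x x.
Proof. exact: dnorm_ge0. Qed.

(** Real-valued, since [inner x x] is a nonnegative real; estimates can then be made in [R]. *)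
Definition sqnorm (R : realType) (n : nat) (x : 'cV[R[i]]_n) : R :=
  complex.Re (inner x x).

Lemma normc_norm (R : realType) (z : R[i]) : `|z| = (Normc.normc z)%:C.
Proof. by []. Qed.

Lemma normc_ge0 (R : realType) (z : R[i]) : 0 <= Normc.normc z.
Proof. by rewrite -ler0c -normc_norm. Qed.

Lemma normc_sum (R : realType) (I : finType) (F : I -> R[i]) :
  Normc.normc (\sum_i F i) <= \sum_i Normc.normc (F i).
Proof.
rewrite -lecR -normc_norm; apply: le_trans (ler_norm_sum _ _ _) _.
by rewrite rmorph_sum.
Qed.

Lemma innerxx (R : realType) (n : nat) (x : 'cV[R[i]]_n) :
  inner x x = (sqnorm x)%:C.
Proof. by rewrite RRe_real // ger0_real // inner_ge0. Qed.

Lemma sqnorm_gt0 (R : realType) (n : nat) (x : 'cV[R[i]]_n) :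
  x != 0 -> 0 < sqnorm x.
Proof. by move=> /inner_gt0; rewrite innerxx ltcR. Qed.

Lemma sqnorm_ge0 (R : realType) (n : nat) (x : 'cV[R[i]]_n) :
  0 <= sqnorm x.
Proof. by have := inner_ge0 x; rewrite innerxx lecR. Qed.

Lemma sqnormE (R : realType) (n : nat) (x : 'cV[R[i]]_n) :
  sqnorm x = \sum_i Normc.normc (x i 0) ^+ 2.
Proof.
apply: complexI; rewrite -innerxx innerE rmorph_sum; apply: eq_bigr => i _.
by rewrite -sqr_normc normc_norm rmorphXn.
Qed.

Lemma enorm_eq1 (R : realType) (n : nat) (x : 'cV[R[i]]_n) :
  enorm x = 1 <-> sqnorm x = 1.
Proof.
split=> [x1 | x1].
  by apply: complexI; rewrite -innerxx -(sqrtCK (inner x x)) -/(enorm x) x1 expr1n.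
by rewrite /enorm innerxx x1 sqrtC1.
Qed.

(** * The numerical radius as a bound on the quadratic form *)

(** Scaling by [1/|x|] carries facts about unit vectors over to all nonzero vectors. *)
Lemma form_normalize (R : realType) (n : nat) (x : 'cV[R[i]]_n) :
  x != 0 -> exists2 y, enorm y = 1 &
    forall A : 'M[R[i]]_n,
      inner (A *m x) x = (sqnorm x)%:C * inner (A *m y) y.
Proof.
move=> /sqnorm_gt0 x_gt0; set c := Num.sqrt (sqnorm x).
have c_neq0 : c != 0 by rewrite gt_eqF ?sqrtr_gt0.
have cc : sqnorm x = c * c by rewrite -expr2 sqr_sqrtr // ltW.
exists (c^-1%:C *: x) => [|A].
  apply/enorm_eq1/complexI; rewrite -innerxx innerZl innerZr innerxx conjc_real.
  by rewrite -!rmorphM cc; congr (_%:C); field.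
rewrite -scalemxAr innerZl innerZr conjc_real !mulrA -!rmorphM cc.
by rewrite mulfK // divff // mul1r.
Qed.

(** Coordinates of a unit vector have modulus at most 1, so the moduli of the entries of [A] sum to
    a bound. This makes the [sup] in [numerical_radius] a genuine upper bound. *)
Lemma numerical_range_has_ubound (R : realType) (n : nat) (A : 'M[R[i]]_n) :
  has_ubound [set Normc.normc z | z in numerical_range A]%classic.
Proof.
exists (\sum_i \sum_j Normc.normc (A i j)) => _ [_ [x /enorm_eq1 x1 <-] <-].
have x_le1 i : Normc.normc (x i 0) <= 1.
  rewrite -(ler_pXn2r (n := 2)) ?nnegrE ?normc_ge0 // expr1n -x1 sqnormE.
  by rewrite (bigD1 i) //= lerDl sumr_ge0 // => j _; exact: exprn_ge0 (normc_ge0 _).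
rewrite innerE; apply: le_trans (normc_sum _) _; apply: ler_sum => i _.
rewrite Normc.normcM mxE.
apply: (@le_trans _ _ (Normc.normc (\sum_j A i j * x j 0) * 1)).
  apply: ler_wpM2l; first exact: normc_ge0.
  by rewrite -lecR -normc_norm normcJ normc_norm lecR.
rewrite mulr1; apply: le_trans (normc_sum _) _; apply: ler_sum => j _.
by rewrite Normc.normcM -[leRHS]mulr1 ler_wpM2l // normc_ge0.
Qed.

Lemma numerical_radius_ge0 (R : realType) (n : nat) (A : 'M[R[i]]_n) :
  0 <= numerical_radius A.
Proof.
rewrite /numerical_radius; set S := (X in sup X).
(* For [n = 0] there is no unit vector, and [sup] of the empty set is 0. *)
have [-> |/set0P [_ [z Az _]]] := eqVneq S set0; first by rewrite sup0.
apply: le_trans (normc_ge0 z) _.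
by apply: ub_le_sup; [exact: numerical_range_has_ubound | exists z].
Qed.

Lemma normc_form_le (R : realType) (n : nat) (A : 'M[R[i]]_n)
    (x : 'cV[R[i]]_n) :
  Normc.normc (inner (A *m x) x) <= numerical_radius A * sqnorm x.
Proof.
have [-> | x0] := eqVneq x 0.
  rewrite mulmx0 /sqnorm innerE big1 ?Normc.normc0 ?mulr0 // => i _.
  by rewrite mxE mul0r.
have [y y1 ->] := form_normalize x0.
have xE : Normc.normc (sqnorm x)%:C = sqnorm x.
  by apply: complexI; rewrite -normc_norm ger0_norm // lecR sqnorm_ge0.
rewrite Normc.normcM xE mulrC ler_wpM2r ?sqnorm_ge0 //.
apply: ub_le_sup; first exact: numerical_range_has_ubound.
by exists (inner (A *m y) y) => //; exists y.
Qed.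

(** * The sector condition *)

(** The sector is a cone, so the positive factor [|x|^2] keeps the form inside it. *)
Lemma sectorial_form (R : realType) (n : nat) (gamma : R) (A : 'M[R[i]]_n)
    (x : 'cV[R[i]]_n) :
  sectorial gamma A -> x != 0 -> sector gamma (inner (A *m x) x).
Proof.
move=> sectA x0; have [y y1 ->] := form_normalize x0.
have /sectA : numerical_range A (inner (A *m y) y) by exists y.
have := sqnorm_gt0 x0; case: (inner (A *m y) y) => a b /= c_gt0 [/= a_gt0 b_le].
rewrite /sector /= !mul0r subr0 addr0; split; first exact: mulr_gt0.
by rewrite normrM (gtr0_norm c_gt0) mulrCA ler_pM2l.
Qed.

(** For [z = a + i b], multiplying [|b| <= tan gamma * a] by [cos gamma], squaring and adding
    [sin^2 gamma * b^2] gives [b^2 <= sin^2 gamma * (a^2 + b^2)]. *)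
Lemma sector_Im_le (R : realType) (gamma : R) (z : R[i]) :
  0 <= gamma -> gamma < pi / 2 -> sector gamma z ->
  `|complex.Im z| <= sin gamma * Normc.normc z.
Proof.
move=> g_ge0 g_lt; case: z => a b [/= a_gt0 b_le].
have c_gt0 : 0 < cos gamma.
  by apply: cos_gt0_pihalf; rewrite g_lt andbT;
     apply: lt_le_trans g_ge0; rewrite oppr_lt0 divr_gt0 ?pi_gt0.
have s_ge0 : 0 <= sin gamma.
  apply: sin_ge0_pi; rewrite g_ge0 /=; have := pi_gt0 R; lra.
have cb_le : cos gamma * `|b| <= sin gamma * a.
  rewrite -(ler_pM2l c_gt0) in b_le; apply: le_trans b_le _.
  by rewrite /tan le_eqVlt; apply/orP; left; apply/eqP; field; rewrite gt_eqF.
rewrite -(ler_pXn2r (n := 2)) ?nnegrE ?mulr_ge0 ?sqrtr_ge0 //.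
rewrite exprMn sqr_sqrtr ?addr_ge0 ?sqr_ge0 //.
have := cos2Dsin2 gamma; have : (cos gamma * `|b|)^+2 <= (sin gamma * a)^+2.
  by rewrite ler_pXn2r // nnegrE mulr_ge0 // ltW.
rewrite !exprMn -normrX (ger0_norm (sqr_ge0 b)).
move=> h1 h2; rewrite -[leLHS]mul1r -h2 mulrDl mulrDr lerD2r; exact: h1.
Qed.

(** * The operator norm bound by polarization *)

Lemma innerNl (R : realType) (n : nat) (x y : 'cV[R[i]]_n) :
  inner (- x) y = - inner x y.
Proof. by rewrite -scaleN1r innerZl mulN1r. Qed.

Lemma innerNr (R : realType) (n : nat) (x y : 'cV[R[i]]_n) :
  inner x (- y) = - inner x y.
Proof. by rewrite innerC innerNl rmorphN /= -innerC. Qed.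

Lemma sqnormZ (R : realType) (n : nat) (c : R[i]) (x : 'cV[R[i]]_n) :
  sqnorm (c *: x) = Normc.normc c ^+ 2 * sqnorm x.
Proof.
apply: complexI; rewrite -innerxx innerZl innerZr mulrA -sqr_normc innerxx.
by rewrite normc_norm -rmorphXn -rmorphM.
Qed.

Lemma sqnorm_parallelogram (R : realType) (n : nat) (x y : 'cV[R[i]]_n) :
  sqnorm (x + y) + sqnorm (x - y) = 2 * (sqnorm x + sqnorm y).
Proof.
rewrite /sqnorm !(innerDl, innerDr, innerNl, innerNr).
case: (inner x x) (inner y y) (inner x y) (inner y x) => a b [c d] [e f] [g h].
by rewrite /=; ring.
Qed.

(* Polarization of the skew-Hermitian part is done in the basis
   [x + y], [x - y], where the weight [t] balances the two vectors. *)
Lemma Re_form_polarization (R : realType) (n : nat) (A : 'M[R[i]]_n)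
    (x y : 'cV[R[i]]_n) (t : R) :
  8 * t * complex.Re (inner (A *m x) y) =
    2 * t * (complex.Re (inner (A *m (x + y)) (x + y)) -
             complex.Re (inner (A *m (x - y)) (x - y))) +
    (complex.Im (inner (A *m (t%:C *: (x + y) + 'i *: (x - y)))
                       (t%:C *: (x + y) + 'i *: (x - y))) -
     complex.Im (inner (A *m (t%:C *: (x + y) - 'i *: (x - y)))
                       (t%:C *: (x + y) - 'i *: (x - y)))).
Proof.
rewrite !(mulmxDr, mulmxN, innerDl, innerDr, innerNl, innerNr, =^~scalemxAr).
rewrite !(innerDl, innerDr, innerNl, innerNr, innerZl, innerZr) conjc_real.
case: (inner (A *m x) x) (inner (A *m x) y) (inner (A *m y) x)
  (inner (A *m y) y) => a b [c d] [e f] [g h].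
by rewrite /=; ring.
Qed.

(** Divided by [2 t], the bound reads [4 r <= w U + s w (t U + V / t)]. The choice [t = s] turns the
    right side into [w U + w (s^2 U + V)], which falls short of the goal by [s^2 w V >= 0]. *)
Lemma le_of_weighted_bounds (R : realType) (s w r U V : R) :
  0 <= s -> 0 <= w -> 0 <= U -> 0 <= V ->
  (forall t, 0 < t ->
    8 * t * r <= 2 * t * (w * U) + s * w * (2 * (t ^+ 2 * U + V))) ->
  4 * r <= (1 + s ^+ 2) * w * (U + V).
Proof.
move=> s_ge0 w_ge0 U_ge0 V_ge0 bound.
have wV_ge0 : 0 <= w * V by rewrite mulr_ge0.
have swV_ge0 : 0 <= s ^+ 2 * (w * V) by rewrite mulr_ge0 ?sqr_ge0.
(* For [s = 0] the choice [t = s] is not positive; the last term vanishes, and [t = 1] suffices. *)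
have [s0 | s_neq0] := eqVneq s 0; first by have := bound 1 ltr01; rewrite s0; lra.
have s_gt0 : 0 < s by rewrite lt_def s_neq0.
suff : 4 * r <= w * U + w * (s ^+ 2 * U + V) by lra.
rewrite -(ler_pM2l s_gt0); have := bound s s_gt0; lra.
Qed.

Lemma Re_form_le (R : realType) (n : nat) (A : 'M[R[i]]_n) (s w : R)
    (x y : 'cV[R[i]]_n) :
  0 <= s -> 0 <= w ->
  (forall z, 0 <= complex.Re (inner (A *m z) z) <= w * sqnorm z) ->
  (forall z, `|complex.Im (inner (A *m z) z)| <= s * w * sqnorm z) ->
  2 * complex.Re (inner (A *m x) y) <=
    (1 + s ^+ 2) * w * (sqnorm x + sqnorm y).
Proof.
move=> s_ge0 w_ge0 ReA ImA.
have key : 4 * complex.Re (inner (A *m x) y) <=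
    (1 + s ^+ 2) * w * (sqnorm (x + y) + sqnorm (x - y)).
  apply: le_of_weighted_bounds; rewrite ?sqnorm_ge0 // => t t_gt0.
  rewrite Re_form_polarization.
  have /andP[_ Reu] := ReA (x + y); have /andP[Rev _] := ReA (x - y).
  apply: lerD.
    apply: ler_wpM2l; first by rewrite mulr_ge0 // ltW.
    (* The subtracted real part at [x - y] is nonnegative and is dropped. *)
    by rewrite lerBlDr; apply: le_trans Reu _; rewrite lerDl.
  have /ler_normlP[_ Imp] := ImA (t%:C *: (x + y) + 'i *: (x - y)).
  have /ler_normlP[Imm _] := ImA (t%:C *: (x + y) - 'i *: (x - y)).
  apply: le_trans (lerD Imp Imm) _.
  (* Parallelogram law for [t (x + y)] and [i (x - y)]. *)
  rewrite -[leLHS]mulrDr [X in _ * X <= _]sqnorm_parallelogram !sqnormZ /=.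
  by rewrite !expr0n !expr1n !addr0 add0r sqrtr1 expr1n mul1r sqr_sqrtr ?sqr_ge0.
move: key; rewrite [X in _ <= _ * X]sqnorm_parallelogram.
set r := complex.Re _; set N := sqnorm x + sqnorm y; clearbody r N; lra.
Qed.

(** Testing with [y = A x / b] and multiplying by [b] gives [2 |A x|^2 <= b^2 |x|^2 + |A x|^2]. *)
Lemma sqnorm_mulmx_le (R : realType) (n : nat) (A : 'M[R[i]]_n) (b : R)
    (x : 'cV[R[i]]_n) :
  0 < b ->
  (forall y, 2 * complex.Re (inner (A *m x) y) <= b * (sqnorm x + sqnorm y)) ->
  sqnorm (A *m x) <= b ^+ 2 * sqnorm x.
Proof.
move=> b_gt0 /(_ (b^-1%:C *: (A *m x))).
rewrite innerZr conjc_real innerxx -rmorphM sqnormZ /=.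
rewrite expr0n addr0 sqr_sqrtr ?sqr_ge0 //=.
move: (sqnorm x) (sqnorm _) => X Y h.
have b_neq0 : b != 0 by rewrite gt_eqF.
have Y2 : b * (2 * (b^-1 * Y)) = 2 * Y by field.
have XY : b * (b * (X + b^-1 ^+ 2 * Y)) = b ^+ 2 * X + Y by field.
have := ler_wpM2l (ltW b_gt0) h; rewrite Y2 XY; lra.
Qed.

(** * Functional calculus in an orthonormal eigenbasis *)

(** For unitary [P], the normal matrix with eigenvalues [f i] on the columns of [P ^t*]. Changing
    [f] with [P] fixed plays the role of functional calculus. *)
Definition unitary_diag (C : numClosedFieldType) (n : nat) (P : 'M[C]_n)
    (f : 'I_n -> C) : 'M[C]_n :=
  P ^t* *m diag_mx (\row_i f i) *m P.

Section UnitaryDiag.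
Variables (C : numClosedFieldType) (n : nat) (P : 'M[C]_n).
Hypothesis unitP : P \is unitarymx.

Lemma unitary_mulVmx : P ^t* *m P = 1%:M.
Proof. by apply: mulmx1C; apply/unitarymxP. Qed.

Lemma unitary_diagM (f g : 'I_n -> C) :
  unitary_diag P f *m unitary_diag P g = unitary_diag P (fun i => f i * g i).
Proof.
rewrite /unitary_diag !mulmxA mulmxtVK // -[X in X *m P]mulmxA mulmx_diag.
by congr (_ *m diag_mx _ *m _); apply/rowP => i; rewrite !mxE.
Qed.

Lemma unitary_diagD (f g : 'I_n -> C) :
  unitary_diag P f + unitary_diag P g = unitary_diag P (fun i => f i + g i).
Proof.
rewrite /unitary_diag -mulmxDl -mulmxDr -linearD /=.
by congr (_ *m diag_mx _ *m _); apply/rowP => i; rewrite !mxE.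
Qed.

Lemma unitary_diag_cst (c : C) : unitary_diag P (fun=> c) = c%:M.
Proof.
rewrite /unitary_diag (_ : \row__ _ = const_mx c);
  last by apply/rowP => i; rewrite !mxE.
by rewrite diag_const_mx scalar_mxC -mulmxA unitary_mulVmx mulmx1.
Qed.

Lemma unitary_diag_adjoint (f : 'I_n -> C) :
  (unitary_diag P f) ^t* = unitary_diag P (fun i => (f i)^*%R).
Proof.
rewrite /unitary_diag !trmx_mul !map_mxM !trmxCK mulmxA tr_diag_mx map_diag_mx.
by congr (_ *m diag_mx _ *m _); apply/rowP => i; rewrite !mxE.
Qed.

(** In the eigenbasis, entry [(i, j)] of the commutation relation reads [a_ij f_j = f_i a_ij]. *)
Lemma commute_unitary_diag_entry (A : 'M[C]_n) (f : 'I_n -> C) :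
  A *m unitary_diag P f = unitary_diag P f *m A ->
  forall i j, (P *m A *m P ^t*) i j != 0 -> f i = f j.
Proof.
move=> comA i j Aij; have : P *m A *m P ^t* *m diag_mx (\row_i f i) =
    diag_mx (\row_i f i) *m (P *m A *m P ^t*).
  move: comA => /(congr1 (fun X => P *m X *m P ^t*)).
  by rewrite /unitary_diag !mulmxA mulmxtVK // (unitarymxP unitP) mul1mx.
move: (P *m A *m P ^t*) Aij => A' Aij /matrixP/(_ i j).
by rewrite mul_diag_mx mul_mx_diag !mxE mulrC => /(mulIf Aij).
Qed.

(** The first hypothesis says that [g] is a function of [f]: what commutes with a normal matrix
    commutes with functions of it. *)
Lemma commute_unitary_diag (A : 'M[C]_n) (f g : 'I_n -> C) :
  (forall i j, f i = f j -> g i = g j) ->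
  A *m unitary_diag P f = unitary_diag P f *m A ->
  A *m unitary_diag P g = unitary_diag P g *m A.
Proof.
move=> fg /commute_unitary_diag_entry Aij.
have : P *m A *m P ^t* *m diag_mx (\row_i g i) =
    diag_mx (\row_i g i) *m (P *m A *m P ^t*).
  move: (P *m A *m P ^t*) Aij => A' Aij.
  apply/matrixP => i j; rewrite mul_diag_mx mul_mx_diag !mxE.
  have [-> | /Aij/fg ->] := eqVneq (A' i j) 0.
    by rewrite mul0r mulr0.
  exact: mulrC.
move=> /(congr1 (fun X => P ^t* *m X *m P)).
by rewrite /unitary_diag !mulmxA unitary_mulVmx mul1mx -!mulmxA unitary_mulVmx mulmx1.
Qed.

End UnitaryDiag.

Lemma normal_unitary_diag (C : numClosedFieldType) (n : nat) (A : 'M[C]_n) :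
  A \is normalmx ->
  exists2 P : 'M[C]_n, P \is unitarymx & exists f, A = unitary_diag P f.
Proof.
move=> /orthomx_spectralP AE; exists (spectralmx A); first exact: spectral_unitarymx.
exists (spectral_diag A 0); rewrite [LHS]AE invmx_unitary ?spectral_unitarymx //.
by congr (_ *m diag_mx _ *m _); apply/rowP => i; rewrite !mxE.
Qed.

Lemma unitary_diag_inj (C : numClosedFieldType) (n : nat) (P : 'M[C]_n)
    (f g : 'I_n -> C) :
  P \is unitarymx -> unitary_diag P f = unitary_diag P g -> f =1 g.
Proof.
move=> unitP /(congr1 (fun X => P *m X *m P ^t*)).
rewrite /unitary_diag !mulmxA (unitarymxP unitP) !mul1mx !mulmxtVK //.
by move=> /matrixP fg i; have := fg i i; rewrite !mxE eqxx !mulr1n.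
Qed.

(** * Multiplication by a commuting unitary matrix *)

(** One chosen index per level set of [f], so that eigenspaces are indexed by [T] itself. The
    default is never reached, since [i] satisfies the predicate. *)
Definition class_rep (T : finType) (V : eqType) (f : T -> V) (i : T) : T :=
  odflt i [pick k | f k == f i].

Lemma class_repK (T : finType) (V : eqType) (f : T -> V) (i : T) :
  f (class_rep f i) = f i.
Proof. by rewrite /class_rep; case: pickP => //= k /eqP. Qed.

Lemma eq_class_rep (T : finType) (V : eqType) (f : T -> V) (i j : T) :
  f i = f j -> class_rep f i = class_rep f j.
Proof.
by rewrite /class_rep => ->; case: pickP => //= /(_ j); rewrite eqxx.
Qed.

(** The form [<A x, x>] as a matrix product, so that a change of basis is mere associativity. *)
Definition mxform (C : numClosedFieldType) (n : nat) (A : 'M[C]_n)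
    (x : 'cV[C]_n) : C := (x ^t* *m A *m x) 0 0.

Section FormMul.
Variables (C : numClosedFieldType) (n : nat).
Implicit Types (A B U P : 'M[C]_n) (x y : 'cV[C]_n).

Lemma mxform_congr A P x : mxform (P ^t* *m A *m P) x = mxform A (P *m x).
Proof. by rewrite /mxform trmx_mul map_mxM !mulmxA. Qed.

Lemma mxform_unitary P x : P \is unitarymx -> mxform 1%:M (P *m x) = mxform 1%:M x.
Proof. by move=> uP; rewrite -mxform_congr mulmx1 unitary_mulVmx. Qed.

Lemma mxformE A x : mxform A x = \sum_j \sum_i (x i 0)^*%R * A i j * x j 0.
Proof.
rewrite /mxform mxE; apply: eq_bigr => j _; rewrite mxE mulr_suml.
by apply: eq_bigr => i _; rewrite !mxE.
Qed.

Lemma mxform1E x : mxform 1%:M x = \sum_i `|x i 0| ^+ 2.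
Proof.
rewrite /mxform mulmx1 mxE; apply: eq_bigr => i _.
by rewrite !mxE normCK mulrC.
Qed.

(** [A] is block diagonal along the level sets of [f], so the form splits into blocks, each
    multiplied by a scalar of modulus one; the squared norms of the components of [x] add up to that
    of [x]. *)
Lemma mxform_diag_le A (f : 'I_n -> C) (w : C) x :
  (forall i, `|f i| = 1) ->
  (forall i j, A i j != 0 -> f i = f j) ->
  (forall y, `|mxform A y| <= w * mxform 1%:M y) ->
  `|mxform (A *m diag_mx (\row_i f i)) x| <= w * mxform 1%:M x.
Proof.
move=> f1 Af Aw; pose p := class_rep f.
(* The component of [x] on the level set represented by [k]; it is zero if [k] represents none. *)
pose z k : 'cV[C]_n := \col_i if p i == k then x i 0 else 0.
have -> : mxform (A *m diag_mx (\row_i f i)) x = \sum_k f k * mxform A (z k).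
  under [RHS]eq_bigr do rewrite mxformE mulr_sumr.
  rewrite mxformE [RHS]exchange_big; apply: eq_bigr => j _ /=.
  under [RHS]eq_bigr do rewrite mulr_sumr.
  rewrite [RHS]exchange_big; apply: eq_bigr => i _ /=.
  rewrite (bigD1 (p j)) //= big1 ?addr0 => [|k /negPf jk]; last first.
by rewrite /z !mxE (eq_sym (p j)) jk !mulr0.
  rewrite mul_mx_diag /z !mxE eqxx class_repK.
  have [-> | /Af/eq_class_rep pij] := eqVneq (A i j) 0;
    first by rewrite !(mul0r, mulr0).
  by rewrite /p pij eqxx; ring.
have -> : mxform 1%:M x = \sum_k mxform 1%:M (z k).
  under [RHS]eq_bigr do rewrite mxform1E.
  rewrite mxform1E [RHS]exchange_big; apply: eq_bigr => i _ /=.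
  rewrite (bigD1 (p i)) //= big1 ?addr0 => [|k /negPf ik]; first by rewrite /z mxE eqxx.
  by rewrite /z !mxE (eq_sym (p i)) ik normr0 expr0n.
rewrite mulr_sumr; apply: le_trans (ler_norm_sum _ _ _) _.
by apply: ler_sum => k _; rewrite normrM f1 mul1r.
Qed.

Lemma mxform_mul_unitary_le A U (w : C) x :
  U \is unitarymx -> A *m U = U *m A ->
  (forall y, `|mxform A y| <= w * mxform 1%:M y) ->
  `|mxform (A *m U) x| <= w * mxform 1%:M x.
Proof.
move=> unitU comAU Aw.
have /normal_unitary_diag[P unitP [f UE]] : U \is normalmx.
  by apply/normalmxP; rewrite (unitarymxP unitU) unitary_mulVmx.
have f1 i : `|f i| = 1.
  (* [U U^* = 1] read on eigenvalues is [|f i|^2 = 1]. *)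
  apply: (@pexpIrn _ 2); rewrite ?nnegrE ?normr_ge0 // normCK expr1n.
  have := unitarymxP unitU; rewrite UE unitary_diag_adjoint unitary_diagM //.
  rewrite -(unitary_diag_cst unitP 1) => /unitary_diag_inj -> //.
rewrite UE in comAU *.
have -> : A *m unitary_diag P f =
    P ^t* *m (P *m A *m P ^t* *m diag_mx (\row_i f i)) *m P.
  by rewrite /unitary_diag !mulmxA unitary_mulVmx // mul1mx.
rewrite mxform_congr -(mxform_unitary x unitP).
apply: mxform_diag_le => // [|y]; first exact: commute_unitary_diag_entry.
have unitPt : P ^t* \is unitarymx by rewrite trmxC_unitary.
have := mxform_congr A (P ^t*) y; rewrite trmxCK => ->.
by rewrite -(mxform_unitary y unitPt).
Qed.

(** * Multiplication by a commuting matrix as an average of two unitary ones *)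

Lemma mxformD A B x : mxform (A + B) x = mxform A x + mxform B x.
Proof. by rewrite /mxform mulmxDr mulmxDl mxE. Qed.

Lemma mxformZ (c : C) A x : mxform (c *: A) x = c * mxform A x.
Proof. by rewrite /mxform -scalemxAr -scalemxAl mxE. Qed.

Lemma mxform_gram B x : mxform (B ^t* *m B) x = mxform 1%:M (B *m x).
Proof. by rewrite -mxform_congr mulmx1. Qed.

(** The vector [P^* e_i] is a unit eigenvector; evaluating there turns bounds on a form into bounds
    on eigenvalues. *)
Lemma mxform_unitary_diag P (f : 'I_n -> C) i :
  P \is unitarymx ->
  mxform (unitary_diag P f) (P ^t* *m delta_mx i 0) = f i.
Proof.
move=> unitP; rewrite mxform_congr mulmxA (unitarymxP unitP) mul1mx.
rewrite mxformE (bigD1 i) //= [X in _ + X]big1 ?addr0 => [|j /negPf ji].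
  rewrite (bigD1 i) //= big1 ?addr0 => [|k /negPf ki].
    by rewrite !mxE !eqxx /= conjC1 mul1r mulr1 mulr1n.
  by rewrite !mxE ki /= conjC0 !mul0r.
by rewrite big1 // => k _; rewrite !mxE ji /= mulr0.
Qed.

(* With [H := B^* B] and [|B| <= b], [B = b (V + V') / 2] where
   [V, V' := B (1/b +- i sqrt (1/H - 1/b^2))] are unitary. *)
Lemma mxform_mul_le A B (w b : C) x :
  0 < b -> A *m B = B *m A -> A *m B ^t* = B ^t* *m A ->
  (forall y, y != 0 -> 0 < mxform (B ^t* *m B) y <= b ^+ 2 * mxform 1%:M y) ->
  (forall y, `|mxform A y| <= w * mxform 1%:M y) ->
  `|mxform (A *m B) x| <= b * w * mxform 1%:M x.
Proof.
move=> b_gt0 comAB comABs normB Aw.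
have comAH : A *m (B ^t* *m B) = B ^t* *m B *m A.
  by rewrite mulmxA comABs -!mulmxA comAB.
have /normal_unitary_diag[P unitP [d HE]] : B ^t* *m B \is normalmx.
  by apply/normalmxP; rewrite trmx_mul map_mxM trmxCK.
have dP i : 0 < d i <= b ^+ 2.
  have := normB (P ^t* *m delta_mx i 0).
  have uPt : P ^t* \is unitarymx by rewrite trmxC_unitary.
  rewrite HE mxform_unitary_diag // mxform_unitary // -(unitary_diag_cst unitP 1).
  have -> : mxform (unitary_diag P (fun=> 1)) (delta_mx i 0) = 1.
    rewrite unitary_diag_cst // mxform1E (bigD1 i) //= big1 => [|j /negPf ji].
      by rewrite mxE !eqxx normr1 expr1n addr0.
    by rewrite mxE ji normr0 expr0n.
  rewrite mulr1; apply; apply/eqP => /(congr1 (mulmx P)).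
  rewrite mulmxA (unitarymxP unitP) mul1mx mulmx0 => /matrixP/(_ i 0)/eqP.
  by rewrite !mxE !eqxx oner_eq0.
have b_real : b \is Num.real by rewrite realE ltW.
(* The sign [e = 1] or [e = -1] selects one of the two unitary factors. *)
pose G e c := b^-1 + 'i%R * (e * sqrtC (c^-1 - b ^- 2)).
pose V e := B *m unitary_diag P (fun i => G e (d i)).
have V_bound e : e \is Num.real -> e ^+ 2 = 1 ->
    `|mxform (A *m V e) x| <= w * mxform 1%:M x.
  move=> e_real ee.
  (* [|G|^2 = 1/b^2 + (1/d - 1/b^2) = 1/d]; the square root is real because [d <= b^2]. *)
  have GG i : (G e (d i))^*%R * d i * G e (d i) = 1.
    have /andP[d_gt0 d_le] := dP i.
    rewrite mulrAC /G conjC_rect ?rpredV //; last first.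
      rewrite rpredM // realE sqrtC_ge0 subr_ge0 lef_pV2 ?posrE ?exprn_gt0 //.
      by rewrite d_le.
    rewrite -subr_sqr exprMn sqrCi mulN1r opprK exprMn ee mul1r sqrtCK.
    by rewrite exprVn addrC subrK mulVf // gt_eqF.
  apply: mxform_mul_unitary_le => //.
    (* [V^* V = G(H)^* H G(H)], which is diagonal in the basis [P] with entries 1. *)
    rewrite -trmxC_unitary; apply/unitarymxP; rewrite trmxCK trmx_mul map_mxM.
    rewrite mulmxA -[X in X *m _]mulmxA HE unitary_diag_adjoint !unitary_diagM //.
    rewrite -(unitary_diag_cst unitP 1); congr unitary_diag.
    by apply/funext => i; exact: GG.
  rewrite mulmxA comAB -[LHS]mulmxA -[RHS]mulmxA; congr (_ *m _).
  apply: (commute_unitary_diag unitP (f := d)); last by rewrite -HE.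
  by move=> i j ->.
have BE : B = (b / 2) *: (V 1 + V (-1)).
  rewrite -mulmxDr unitary_diagD.
  (* The imaginary parts of [G 1] and [G (-1)] cancel. *)
  rewrite (_ : (fun i => _) = (fun=> 2 / b)); last first.
    by apply/funext => i; rewrite /G; field; rewrite gt_eqF.
  rewrite unitary_diag_cst // mul_mx_scalar scalerA -[LHS]scale1r.
  by congr (_ *: _); field; rewrite gt_eqF.
have Vx := V_bound 1 (rpred1 _) (expr1n _ _).
have V'x := V_bound (-1) (rpredN1 _) (sqrr_sign _ 1).
rewrite [in leLHS]BE -scalemxAr mulmxDr mxformZ mxformD normrM.
have b2_ge0 : 0 <= b / 2 by rewrite divr_ge0 ?ler0n // ltW.
rewrite (ger0_norm b2_ge0).
apply: (@le_trans _ _ (b / 2 * (w * mxform 1%:M x + w * mxform 1%:M x))).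
  by rewrite ler_wpM2l //; apply: le_trans (ler_normD _ _) _; rewrite lerD.
by rewrite le_eqVlt; apply/orP; left; apply/eqP; field.
Qed.

End FormMul.

(** * Sectorial matrices and the final estimate *)

Lemma mxform_inner (R : realType) (n : nat) (A : 'M[R[i]]_n)
    (x : 'cV[R[i]]_n) :
  mxform A x = inner (A *m x) x.
Proof.
rewrite mxformE innerE exchange_big; apply: eq_bigr => i _ /=.
rewrite [in RHS]mxE mulr_suml; apply: eq_bigr => j _.
by rewrite -mulrA mulrC.
Qed.

Lemma mxform1_sqnorm (R : realType) (n : nat) (x : 'cV[R[i]]_n) :
  mxform 1%:M x = (sqnorm x)%:C.
Proof. by rewrite mxform_inner mul1mx innerxx. Qed.

(** Polarization applied with [s = sin gamma] and [w] the numerical radius, whose positivity allows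
    the division by [b = (1 + s^2) w]. *)
Lemma sectorial_sqnorm_le (R : realType) (n : nat) (gamma : R)
    (A : 'M[R[i]]_n) (x : 'cV[R[i]]_n) :
  0 <= gamma -> gamma < pi / 2 -> sectorial gamma A -> 0 < numerical_radius A ->
  sqnorm (A *m x) <=
    ((1 + sin gamma ^+ 2) * numerical_radius A) ^+ 2 * sqnorm x.
Proof.
move=> g_ge0 g_lt sectA w_gt0.
have s_ge0 : 0 <= sin gamma.
  by apply: sin_ge0_pi; rewrite g_ge0 /=; have := pi_gt0 R; lra.
have form0 : inner (A *m (0 : 'cV_n)) 0 = 0.
  by rewrite -mxform_inner mxformE big1 // => j _;
     rewrite big1 // => i _; rewrite !mxE mulr0.
apply: sqnorm_mulmx_le => [|y].
  by rewrite mulr_gt0 // ltr_pwDl ?sqr_ge0.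
apply: Re_form_le => // [||z]; first exact: ltW.
  move=> z; apply/andP; split.
    have [-> | z0] := eqVneq z 0; first by rewrite form0.
    by have [/ltW] := sectorial_form sectA z0.
  apply: le_trans (normc_form_le A z).
  apply: le_trans (ler_norm _) _.
  by rewrite -lecR -normc_norm normc_ge_Re.
have [-> | z0] := eqVneq z 0.
  by rewrite form0 normr0 mulr_ge0 ?sqnorm_ge0 // mulr_ge0 // ltW.
apply: le_trans (sector_Im_le g_ge0 g_lt (sectorial_form sectA z0)) _.
by rewrite -mulrA ler_wpM2l // normc_form_le.
Qed.

Theorem corollary2p17 (R : realType) (n : nat) (gamma : R)
    (A B : 'M[R[i]]_n)
    (gamma_ge0 : 0 <= gamma) (gamma_lt : gamma < pi / 2)
    (sectA : sectorial gamma A) (sectB : sectorial gamma B)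
    (comAB : A *m B = B *m A) (comABs : A *m B ^t* = B ^t* *m A) :
  numerical_radius (A *m B) <=
    (1 + sin gamma ^+ 2) * numerical_radius A * numerical_radius B.
Proof.
(* The factor [1 + sin^2 gamma] is grouped with the radius of [B], whose operator norm it
   controls. *)
rewrite [leRHS]mulrAC {1}/numerical_radius; set S := (X in sup X).
have s_gt0 : 0 < 1 + sin gamma ^+ 2 by rewrite ltr_pwDl ?sqr_ge0.
have [-> |/set0P S_neq0] := eqVneq S set0.
  by rewrite sup0 !mulr_ge0 ?numerical_radius_ge0 // ltW.
(* The sector excludes 0, which yields both the injectivity of [B] and the positivity of its
   radius. *)
have formB y : y != 0 -> 0 < Normc.normc (inner (B *m y) y).
  move=> y0; have [Re_gt0 _] := sectorial_form sectB y0.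
  rewrite lt_neqAle normc_ge0 andbT; move: Re_gt0.
  apply: contraTneq => /esym/Normc.eq0_normc ->.
  by rewrite ltxx.
have w_gt0 : 0 < numerical_radius B.
  have [_ [_ [x /enorm_eq1 x1 _] _]] := S_neq0.
  have x0 : x != 0.
    apply/eqP => x0; move: x1; rewrite x0 sqnormE big1 => [/eqP|i _].
      by rewrite eq_sym oner_eq0.
    by rewrite mxE Normc.normc0 expr0n.
  by apply: lt_le_trans (formB x x0) _; rewrite -[leRHS]mulr1 -x1 normc_form_le.
apply: ge_sup => // _ [_ [x /enorm_eq1 x1 <-] <-].
rewrite -lecR -normc_norm -mxform_inner -[X in _ <= X%:C]mulr1.
rewrite -[X in _ <= (_ * X)%:C]x1.
rewrite !rmorphM /= -mxform1_sqnorm.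
apply: mxform_mul_le => // [|y y0|y].
- by rewrite -rmorphM ltcR mulr_gt0.
- rewrite mxform_gram !mxform1_sqnorm -[X in X ^+ 2]rmorphM -rmorphXn -rmorphM.
  rewrite ltcR lecR.
  rewrite sectorial_sqnorm_le // andbT sqnorm_gt0 //.
  (* [B y = 0] would make the form of [B] vanish at [y]. *)
  apply: contraTneq (formB y y0) => ->.
  by rewrite innerE big1 => [|i _]; rewrite ?mxE ?mul0r ?Normc.normc0 ?ltxx.
- by rewrite mxform_inner mxform1_sqnorm -rmorphM normc_norm lecR normc_form_le.
Qed.
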